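(* Fix $d\in\mathbb{N}$ and positive shape parameters $\gamma_1,\dots,\gamma_d$. Let $H_d$ be the reproducing kernel Hilbert space of real functions on $\mathbb{R}^d$ with reproducing kernel $K_d(\mathbf{x},\mathbf{t})=\exp\!\big(-\sum_{\ell=1}^d\gamma_\ell^2(x_\ell-t_\ell)^2\big)$. Let $e^{\rm wor-all}(n,H_d)$ and $e^{\rm wor-std}(n,H_d)$ be the $n$th minimal worst case errors of approximating the embedding $I_d:H_d\to\mathcal{L}_2(\mathbb{R}^d,\rho_d)$ defined in the context. Then for every $p>0$ there is a constant $C_{d,p}$, which may depend on $d$ and $p$ but not on $n$, such that $$e^{\rm wor-all}(n,H_d)\le e^{\rm wor-std}(n,H_d)\le C_{d,p}\,n^{-p}\qquad\text{for all } n\in\mathbb{N}.$$ Equivalently, the rates of convergence of both sequences $\{e^{\rm wor-all}(n,H_d)\}_{n}$ and $\{e^{\rm wor-std}(n,H_d)\}_{n}$ are infinite.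
   Context: $\rho_d(\mathbf{t})=\pi^{-d/2}\exp(-\|\mathbf{t}\|^2)$ is the Gaussian density on $\mathbb{R}^d$ with mean zero and covariance $\tfrac12 I$, and $\mathcal{L}_2=\mathcal{L}_2(\mathbb{R}^d,\rho_d)$ has norm $\|f\|_{\mathcal{L}_2}^2=\int_{\mathbb{R}^d}f(\mathbf{t})^2\rho_d(\mathbf{t})\,d\mathbf{t}$. $I_d f=f$ is the embedding of $H_d$ into $\mathcal{L}_2$. A linear algorithm has the form $A_n(f)=\sum_{j=1}^n L_j(f)a_j$ with $a_j\in\mathcal{L}_2$ and continuous linear functionals $L_j$ on $H_d$. Its worst case error is $e^{\rm wor}(A_n)=\sup_{\|f\|_{H_d}\le1}\|f-A_n(f)\|_{\mathcal{L}_2}$. $\Lambda^{\rm all}$ is the class of all continuous linear functionals on $H_d$. $\Lambda^{\rm std}$ is the class of function evaluations $f\mapsto f(\mathbf{t})$, $\mathbf{t}\in\mathbb{R}^d$. $e^{\rm wor-\cdot}(n,H_d)=\inf e^{\rm wor}(A_n)$, where the infimum is over all such $A_n$ with every $L_j$ in $\Lambda^{\rm all}$, respectively in $\Lambda^{\rm std}$. The rate of convergence of a nonincreasing sequence $\{e_n\}$ is $\sup\{\beta\ge0:\lim_{n\to\infty}e_n n^\beta=0\}$. *)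

(* Defs.v *)
From HB Require Import structures.
From mathcomp Require Import all_boot all_order all_algebra.
From mathcomp Require Import all_classical all_reals all_analysis.
Set Implicit Arguments. Unset Strict Implicit. Unset Printing Implicit Defensive.
Import Order.TTheory GRing.Theory Num.Theory.
Import numFieldNormedType.Exports.
Local Open Scope classical_set_scope.
Local Open Scope ring_scope.

Section Defs.
Variable R : realType.

Definition gauss_kernel (d : nat) (gamma : 'I_d -> R) (x t : 'rV[R]_d) : R :=
  expR (- \sum_(l < d) gamma l ^+ 2 * (x ord0 l - t ord0 l) ^+ 2).

Definition rho (d : nat) (t : 'rV[R]_d) : R :=
  pi `^ (- (d%:R / 2)) * expR (- \sum_(l < d) t ord0 l ^+ 2).

(* Iterated Lebesgue integral over R^d (coordinate by coordinate) of a
   nonnegative extended-real function; by Tonelli this is the Lebesgue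
   integral over R^d for nonnegative measurable integrands. *)
Fixpoint iint (d : nat) : ('rV[R]_d -> \bar R) -> \bar R :=
  match d with
  | 0 => fun F => F 0
  | k.+1 => fun F =>
      (\int[@lebesgue_measure R]_x iint (fun v : 'rV[R]_k =>
                                   F (row_mx (const_mx x : 'rV[R]_1) v)))%E
  end.

Definition borel_measurable_d (d : nat) (f : 'rV[R]_d -> R) : Prop :=
  forall B : set R, measurable B ->
    <<s (@open 'rV[R]_d) >> (f @^-1` B).

Definition L2norm2 (d : nat) (g : 'rV[R]_d -> R) : \bar R :=
  iint (fun t => ((g t) ^+ 2 * rho t)%:E).
Definition L2norm (d : nat) (g : 'rV[R]_d -> R) : \bar R :=
  sqrte (L2norm2 g).

Definition inL2 (d : nat) (g : 'rV[R]_d -> R) : Prop :=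
  borel_measurable_d g /\ (L2norm2 g < +oo)%E.

(* RKHS norm of f for the kernel K (Moore-Aronszajn): the supremum of
   sum_i a_i f(x_i) over all finite kernel combinations
   g = sum_i a_i K(., x_i) with ||g||_H^2 = sum_{i,j} a_i a_j K(x_i,x_j) <= 1.
   It equals ||f||_{H(K)} when f is in H(K), and +oo otherwise. *)
Definition Hnorm (d : nat) (gamma : 'I_d -> R) (f : 'rV[R]_d -> R) : \bar R :=
  ereal_sup [set r : \bar R | exists (m : nat) (a : 'I_m -> R)
                                     (xs : 'I_m -> 'rV[R]_d),
     \sum_(i < m) \sum_(j < m) a i * a j * gauss_kernel gamma (xs i) (xs j) <= 1
     /\ r = (\sum_(i < m) a i * f (xs i))%:E].

Definition inH (d : nat) (gamma : 'I_d -> R) (f : 'rV[R]_d -> R) : Prop :=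
  (Hnorm gamma f < +oo)%E.

Definition cont_lin_functional (d : nat) (gamma : 'I_d -> R)
    (L : ('rV[R]_d -> R) -> R) : Prop :=
  (forall (f g : 'rV[R]_d -> R) (a b : R), inH gamma f -> inH gamma g ->
      L (fun t => a * f t + b * g t) = a * L f + b * L g) /\
  exists c : R, forall f, inH gamma f -> (`|L f|%:E <= c%:E * Hnorm gamma f)%E.

Definition std_functional (d : nat) (L : ('rV[R]_d -> R) -> R) : Prop :=
  exists t : 'rV[R]_d, forall f, L f = f t.

Definition lin_alg (d n : nat) (L : 'I_n -> ('rV[R]_d -> R) -> R)
    (a : 'I_n -> 'rV[R]_d -> R) (f : 'rV[R]_d -> R) : 'rV[R]_d -> R :=
  fun t => \sum_(j < n) L j f * a j t.

Definition e_wor (d n : nat) (gamma : 'I_d -> R)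
    (L : 'I_n -> ('rV[R]_d -> R) -> R) (a : 'I_n -> 'rV[R]_d -> R) : \bar R :=
  ereal_sup [set L2norm (fun t => f t - lin_alg L a f t) |
               f in [set f | inH gamma f /\ (Hnorm gamma f <= 1)%E]].

Definition e_min (d : nat) (gamma : 'I_d -> R)
    (Lam : (('rV[R]_d -> R) -> R) -> Prop) (n : nat) : \bar R :=
  ereal_inf [set e : \bar R | exists (L : 'I_n -> ('rV[R]_d -> R) -> R)
                                     (a : 'I_n -> 'rV[R]_d -> R),
      (forall j, Lam (L j)) /\ (forall j, inL2 (a j)) /\ e = e_wor gamma L a].

Definition e_wor_all (d : nat) (gamma : 'I_d -> R) (n : nat) : \bar R :=
  e_min gamma (cont_lin_functional gamma) n.
Definition e_wor_std (d : nat) (gamma : 'I_d -> R) (n : nat) : \bar R :=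
  e_min gamma (@std_functional d) n.

End Defs.

(* Main.v *)
(* If [||f||_H <= 1] then [|\sum_i a_i f(x_i)|] is at most the square root of the
   kernel quadratic form of [a], so the error [f(t) - \sum_q w_q(t) f(x_q)] of a
   sampling formula is controlled by the kernel alone.  In a cell with corner [c],
   put u = x - c, v = y - c; then
     K(x, y) = exp(- \sum g_l^2 u_l^2) exp(- \sum g_l^2 v_l^2) exp(2 \sum g_l^2 u_l v_l).
   Tensor Lagrange interpolation with [k] nodes per coordinate, after rescaling by
   the first two factors, annihilates the Taylor polynomial of degree < [k] of the
   last one, so on a cell of side 1/M the error is O(M^-k).  Cutting [-M, M)^d into
   cells uses O(M^(2d)) samples; outside this cube the zero approximation has error
   at most 1, which the Gaussian weight makes negligible.  As [k] is arbitrary,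
   this beats every power of n. *)
Require Import Defs.
From HB Require Import structures.
From mathcomp Require Import all_boot all_order all_algebra.
From mathcomp Require Import all_classical all_reals all_analysis.
From mathcomp Require Import measurable_realfun.
From mathcomp Require Import ring lra.
Import Order.TTheory GRing.Theory Num.Theory.
Import numFieldNormedType.Exports.
Local Open Scope classical_set_scope.
Local Open Scope ring_scope.
Set Implicit Arguments.
Unset Strict Implicit.
Unset Printing Implicit Defensive.

(** * Elementary bounds for exponentials and polynomials *)

(** The tail from index [k] is compared termwise with |z|^k times the exponential series at |z|,
    using (i + k)! >= i!; the bound on partial sums passes to the limit. *)
Lemma expR_taylor_le (R : realType) (k : nat) (z : R) :
  `|expR z - \sum_(i < k) z ^+ i / i`!%:R| <= `|z| ^+ k * expR `|z|.
Proof.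
have cz := @is_cvg_series_exp_coeff R z.
have cnz := @is_cvg_series_exp_coeff R `|z|.
pose S := \sum_(i < k) z ^+ i / i`!%:R.
have : (fun n => `|series (exp_coeff z) n - S|) @ \oo --> `|expR z - S|.
  by apply: (cvg_norm (V := R^o)); apply: cvgB => //; exact: cvg_cst.
move=> /cvg_lim <- //; apply: limr_le.
  apply: is_cvg_norm; apply: is_cvgB => //; exact: is_cvg_cst.
near=> n.
have kn : (k <= n)%N by near: n; exact: nbhs_infty_ge.
rewrite /S /series /= -(big_mkord xpredT (fun i => z ^+ i / i`!%:R)).
rewrite (big_cat_nat (leq0n k) kn) /= addrAC subrr add0r.
apply: le_trans (ler_norm_sum _ _ _) _.
rewrite -{1}(addn0 k) addnC -{1}(subnK kn) big_addn addnK.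
apply: le_trans (_ : `|z| ^+ k * series (exp_coeff `|z|) (n - k)%N <= _).
  rewrite /series /= mulr_sumr; apply: ler_sum => i _.
  rewrite normrM normrX exprD (mulrC (_ ^+ i)) -mulrA.
  rewrite ler_wpM2l ?exprn_ge0// /exp_coeff /= ler_wpM2l ?exprn_ge0//.
  rewrite gtr0_norm ?invr_gt0 ?ltr0n ?fact_gt0// lef_pV2 ?posrE ?ltr0n ?fact_gt0//.
  by rewrite ler_nat leq_fact// leq_addr.
rewrite ler_wpM2l ?exprn_ge0//.
apply: nondecreasing_cvgn_le => //.
apply/nondecreasing_seqP => m; rewrite /series /= big_nat_recr//= lerDl.
exact: exp_coeff_ge0.
Unshelve. all: by end_near. Qed.

Lemma expR_ge_pow (R : realType) (k : nat) (y : R) :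
  0 <= y -> y ^+ k <= k`!%:R * expR y.
Proof.
move=> y0; rewrite mulrC -ler_pdivrMr ?ltr0n ?fact_gt0//.
case: k => [|k]; first by rewrite expr0 fact0 divr1 -expR0 ler_expR.
by apply: le_trans (expR_ge1Dxn k y0); rewrite lerDr.
Qed.

Lemma horner_le_sum (R : realType) (p : {poly R}) (s T : R) :
  `|s| <= T -> `|p.[s]| <= \sum_(i < size p) `|p`_i| * T ^+ i.
Proof.
move=> sT; rewrite horner_coef; apply: le_trans (ler_norm_sum _ _ _) _.
apply: ler_sum => i _; rewrite normrM normrX ler_wpM2l//.
by rewrite lerXn2r ?nnegrE// (le_trans _ sT).
Qed.

(** * Tensor Lagrange interpolation at integer nodes *)

Section node_basis.
Context {R : realType} (k : nat).

Definition node_basis (q : 'I_k) : {poly R} :=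
  tnth (lagrange k (fun j : nat => j%:R : R)) q.

(** Lagrange interpolation at the nodes 0, ..., k - 1 reproduces every polynomial of degree below
    [k]. *)
Lemma node_basis_exact (e : nat) (s : R) : (e < k)%N ->
  \sum_(q < k) (node_basis q).[s] * q%:R ^+ e = s ^+ e.
Proof.
move=> ek.
have natr_inj : injective (fun j : nat => j%:R : R).
  by move=> i j /eqP; rewrite eqr_nat => /eqP.
have k0 : (0 < k)%N by case: k ek.
have sX : (size ('X^e : {poly R}) <= k)%N by rewrite size_polyXn.
have /(congr1 (fun p => p.[s])) := lagrange_gen k0 natr_inj sX.
rewrite hornerXn horner_sum => ->; apply: eq_bigr => q _.
by rewrite hornerM hornerC hornerXn mulrC.
Qed.

Lemma node_basis_bounded : exists B : R, 1 <= B /\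
  forall (q : 'I_k) s, 0 <= s <= k%:R -> `|(node_basis q).[s]| <= B.
Proof.
pose b (q : 'I_k) : R :=
  \sum_(i < size (node_basis q)) `|(node_basis q)`_i| * k%:R ^+ i.
have b0 q : 0 <= b q by apply: sumr_ge0 => i _; rewrite mulr_ge0// exprn_ge0.
exists (1 + \sum_q b q); split; first by rewrite lerDl sumr_ge0.
move=> q s /andP[s0 sk]; apply: le_trans (_ : b q <= _).
  by apply: horner_le_sum; rewrite ger0_norm.
rewrite (bigD1 q)//= addrCA lerDl addr_ge0// sumr_ge0// => i _; exact: b0.
Qed.

(** The power of the linear form is expanded over all maps [f] from factors to coordinates. Each
    monomial has degree at most n < k in every coordinate, and the sum over [q] splits into
    one-dimensional sums where interpolation is exact. *)
Lemma prod_node_basis_exact (d n : nat) (w s : 'I_d -> R) : (n < k)%N ->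
  \sum_(q : {ffun 'I_d -> 'I_k})
    (\prod_l (node_basis (q l)).[s l]) * (\sum_l w l * (q l)%:R) ^+ n
  = (\sum_l w l * s l) ^+ n.
Proof.
move=> nk.
have multinom (v : 'I_d -> R) : (\sum_l w l * v l) ^+ n =
    \sum_(f : {ffun 'I_n -> 'I_d})
      (\prod_i w (f i)) * \prod_l v l ^+ #|[pred i | f i == l]|.
  rewrite -{1}(card_ord n) -prodr_const bigA_distr_bigA/=.
  apply: eq_bigr => f _; rewrite big_split/=; congr (_ * _).
  rewrite (partition_big f xpredT)//=; apply: eq_bigr => l _.
  rewrite -prodr_const; apply: eq_big => // i /eqP -> //.
under eq_bigr do rewrite multinom mulr_sumr.
rewrite multinom exchange_big/=; apply: eq_bigr => f _.
under eq_bigr do rewrite mulrCA -big_split/=.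
rewrite -mulr_sumr; congr (_ * _).
rewrite -(bigA_distr_bigA (fun l q => (node_basis q).[s l] * q%:R ^+ _))/=.
apply: eq_bigr => l _; apply: node_basis_exact.
by rewrite (leq_ltn_trans _ nk)// (leq_trans (max_card _))// card_ord.
Qed.

End node_basis.

(** * Iterated integrals against the Gaussian weight *)

(* The integral of a nonnegative function is a supremum of integrals of simple
   functions below it, so monotonicity needs no measurability. *)
Lemma le_nnintegral d (T : measurableType d) (R : realType)
    (mu : {measure set T -> \bar R}) (f g : T -> \bar R) :
  (forall x, 0 <= f x)%E -> (forall x, f x <= g x)%E ->
  (\int[mu]_x f x <= \int[mu]_x g x)%E.
Proof.
move=> f0 fg.
have g0 x : (0 <= g x)%E by exact: le_trans (fg x).
rewrite !ge0_integralTE//; apply: ereal_sup_le => _ [h hf <-].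
by exists h => // x; exact: le_trans (fg x).
Qed.

Section iterated_integral.
Context {R : realType}.

Lemma iint_ge0 d (F : 'rV[R]_d -> \bar R) :
  (forall t, 0 <= F t)%E -> (0 <= iint F)%E.
Proof.
elim: d F => [|d IH] F F0 //=; apply: integral_ge0 => x _; exact: IH.
Qed.

Lemma le_iint d (F G : 'rV[R]_d -> \bar R) :
  (forall t, 0 <= F t)%E -> (forall t, F t <= G t)%E -> (iint F <= iint G)%E.
Proof.
elim: d F G => [|d IH] F G F0 FG //=.
by apply: le_nnintegral => x; [exact: iint_ge0|exact: IH].
Qed.

(** Induction on the dimension: the first coordinate is integrated last, and until then its density
    value is absorbed into the constant [c]. *)
Lemma iint_prod_normal_pdf d (c : R) : 0 <= c ->
  iint (fun t : 'rV[R]_d => (c * \prod_l normal_pdf 0 1 (t ord0 l))%:E) = c%:E.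
Proof.
elim: d c => [|d IH] c c0 /=; first by rewrite big_ord0 mulr1.
transitivity (\int[@lebesgue_measure R]_x (c%:E * (normal_pdf 0 1 x)%:E))%E.
  apply: eq_integral => x _; rewrite -EFinM -IH; last first.
    by rewrite mulr_ge0 ?normal_pdf_ge0.
  congr iint; apply/funext => v; rewrite big_ord_recl mulrA.
  congr (_ * _ * _)%:E.
    by rewrite mxE; case: splitP => j; rewrite ?mxE.
  apply: eq_bigr => l _; rewrite mxE; case: splitP => j.
    by rewrite (ord1 j).
  by move=> /eqP; rewrite eqSS => /eqP/val_inj ->.
rewrite integralZl//; last exact: integrable_normal_pdf.
by rewrite integral_normal_pdf mule1.
Qed.

(** Half of the Gaussian exponent pays for the growth of [g]: what remains is a multiple of the
    standard normal density, and [K] is the ratio of the normalisations. *)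
Lemma L2norm2_le d : exists2 K : R, 0 < K &
  forall (B : R) (g : 'rV[R]_d -> R), 0 <= B ->
    (forall t, g t ^+ 2 <= B * expR (\sum_l t ord0 l ^+ 2 / 2)) ->
    (L2norm2 g <= (B * K)%:E)%E.
Proof.
have n1 : (1 : R) != 0 by exact: oner_neq0.
pose K : R := pi `^ (- (d%:R / 2)) / normal_peak 1 ^+ d.
have K0 : 0 < K.
  by rewrite divr_gt0 ?powR_gt0 ?pi_gt0// exprn_gt0// normal_peak_gt0.
exists K => //.
move=> B g B0 gB; rewrite -(@iint_prod_normal_pdf d) ?(mulr_ge0 B0 (ltW K0))//.
apply: le_iint => t.
  by rewrite lee_fin mulr_ge0 ?sqr_ge0// mulr_ge0 ?powR_ge0 ?expR_ge0.
rewrite lee_fin; apply: le_trans (ler_wpM2r _ (gB t)) _.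
  by rewrite mulr_ge0 ?powR_ge0 ?expR_ge0.
rewrite -!mulrA ler_wpM2l// /K /rho mulrCA ler_wpM2l ?powR_ge0//.
rewrite -expRD ler_pdivlMl ?exprn_gt0 ?normal_peak_gt0//.
rewrite -[X in _ ^+ X](card_ord d) -prodr_const -sumrN -big_split/= expR_sum.
rewrite -big_split/=; apply: ler_prod => l _.
rewrite mulr_ge0 ?normal_peak_ge0 ?expR_ge0//=.
rewrite normal_pdfE//= ler_wpM2l ?normal_peak_ge0// ler_expR /normal_fun.
by rewrite subr0 expr1n mulNr; lra.
Qed.

End iterated_integral.

(** * Duality between the norm and kernel combinations *)

Section duality.
Context {R : realType} {d : nat} (gamma : 'I_d -> R).
Implicit Types f : 'rV[R]_d -> R.

(** Dividing the coefficients by [s], with either sign, gives a competitor in the supremum defining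
    [Hnorm]; the two signs together bound the absolute value. *)
Lemma Hnorm_le1_dual f (I : finType) (a : I -> R) (xs : I -> 'rV[R]_d) (s : R) :
  (Hnorm gamma f <= 1)%E -> 0 < s ->
  \sum_i \sum_j a i * a j * gauss_kernel gamma (xs i) (xs j) <= s ^+ 2 ->
  `|\sum_i a i * f (xs i)| <= s.
Proof.
move=> f1 s0; have ev : {on xpredT, bijective (@enum_val I I)}.
  by apply: onW_bij; exact: enum_val_bij.
rewrite (reindex _ ev) [X in `|X|](reindex _ ev)/=.
under eq_bigr do rewrite (reindex _ ev)/=.
set b := fun i : 'I_#|I| => a (enum_val i).
set ys := fun i : 'I_#|I| => xs (enum_val i) => Q.
have scaled (e : R) : e ^+ 2 = 1 -> e * (\sum_i b i * f (ys i)) <= s.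
  move=> e1; rewrite -[leRHS]mulr1 -ler_pdivrMl// mulrA mulr_sumr -lee_fin.
  apply: le_trans f1; apply: ereal_sup_ubound.
  exists #|I|, (fun i => s^-1 * e * b i), ys; split; last first.
    by congr EFin; apply: eq_bigr => i _; rewrite !mulrA.
  under eq_bigr => i _ do under eq_bigr => j _ do
    rewrite mulrACA -expr2 exprMn e1 mulr1 -mulrA.
  under eq_bigr do rewrite -mulr_sumr.
  by rewrite -mulr_sumr exprVn ler_pdivrMl ?exprn_gt0// mulr1.
rewrite ler_norml lerNl -mulN1r scaled ?sqrrN ?expr1n//=.
by rewrite -[leLHS]mul1r scaled ?expr1n.
Qed.

(** The competitor is the single kernel at [t] with the sign of [f t] as coefficient; it is
    admissible because K(t, t) = 1. *)
Lemma Hnorm_ge_eval f (t : 'rV[R]_d) : (`|f t|%:E <= Hnorm gamma f)%E.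
Proof.
apply: ereal_sup_ubound.
exists 1%N, (fun=> Num.sg (f t)), (fun=> t).
rewrite !big_ord1 normrEsg; split=> //.
rewrite /gauss_kernel big1 => [|l _]; last by rewrite subrr expr0n mulr0.
by rewrite oppr0 expR0 mulr1 -expr2 sqr_sg lern1 leq_b1.
Qed.

End duality.

(** * Interpolation error on one cell *)

Section one_cell.
Context {R : realType} (k : nat).

(* Coefficients of polynomial interpolation, applied not to [f] but to
   [f x * expR (g ^+ 2 * (x - c) ^+ 2)]: this factor turns the Gaussian kernel
   into the power series [expR (2 * g ^+ 2 * (x - c) * (y - c))]. *)
Definition cell_coef (g h c x : R) (q : 'I_k) : R :=
  (node_basis q).[(x - c) / h] *
  expR (g ^+ 2 * ((q%:R * h) ^+ 2 - (x - c) ^+ 2)).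

Definition cell_node d (h : R) (c : 'I_d -> R) (q : 'I_d -> 'I_k) : 'rV[R]_d :=
  \row_l (c l + (q l)%:R * h).

(** By duality it suffices to bound the kernel quadratic form of the error functional. Interpolation
    cancels the Taylor polynomial, the form is of order (k h)^(2k), and its square root gives
    [h ^+ k]. *)
Lemma cell_error d (gamma : 'I_d -> R) : exists2 C : R, 0 < C &
  forall f, (Hnorm gamma f <= 1)%E ->
  forall (h : R) (c : 'I_d -> R) (t : 'rV[R]_d), 0 < h -> k%:R * h <= 1 ->
  (forall l, 0 <= t ord0 l - c l <= k%:R * h) ->
  `|f t - \sum_(q : {ffun 'I_d -> 'I_k})
       (\prod_l cell_coef (gamma l) h (c l) (t ord0 l) (q l)) *
       f (cell_node h c q)| <= C * h ^+ k.
Proof.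
have [B [B1 basisB]] := @node_basis_bounded R k.
pose A : R := 1 + \sum_(q : {ffun 'I_d -> 'I_k}) \prod_(l < d) B.
have B0 : 0 <= B by exact: le_trans B1.
have A1 : 1 <= A.
  by rewrite lerDl sumr_ge0// => q _; rewrite prodr_ge0.
pose G : R := 1 + \sum_l 2 * gamma l ^+ 2.
have gamma0 l : 0 <= 2 * gamma l ^+ 2 by rewrite mulr_ge0// sqr_ge0.
have G1 : 1 <= G by rewrite lerDl sumr_ge0.
have A0 : 0 < A by exact: lt_le_trans A1.
have Gpos : 0 < G by exact: lt_le_trans G1.
have G0 := ltW Gpos.
pose kk : R := k%:R ^+ k.
have kk0 : 0 < kk.
  by rewrite /kk; case: (posnP k) => [->|k0]; rewrite ?expr0// exprn_gt0 ?ltr0n.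
have C0 : 0 < A * G ^+ k * expR G * kk.
  by rewrite mulr_gt0// !mulr_gt0 ?expR_gt0 ?exprn_gt0.
exists (A * G ^+ k * expR G * kk) => //.
move=> f f1 h c t h0 kh1 tc.
pose s l := (t ord0 l - c l) / h.
have sk l : 0 <= s l <= k%:R.
  have /andP[? ?] := tc l.
  by rewrite divr_ge0 ?(ltW h0)//= ler_pdivrMr.
(* The index [inl] stands for the target [t], [inr q] for a node; [u] is the displacement from the
   corner, and [beta] is the error functional of polynomial interpolation. *)
pose u (i : 'I_1 + {ffun 'I_d -> 'I_k}) l : R :=
  if i is inr q then (q l)%:R * h else s l * h.
pose beta (i : 'I_1 + {ffun 'I_d -> 'I_k}) : R :=
  if i is inr q then - \prod_l (node_basis (q l)).[s l] else 1.
have uk i l : 0 <= u i l <= k%:R * h.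
  case: i => [j|q] /=; last first.
    by rewrite mulr_ge0 ?ler0n ?(ltW h0)//= ler_wpM2r ?(ltW h0)// ler_nat ltnW.
  by have /andP[? ?] := sk l; rewrite mulr_ge0 ?(ltW h0)//= ler_wpM2r ?(ltW h0).
pose sq i : R := \sum_l gamma l ^+ 2 * u i l ^+ 2.
pose i0 : 'I_1 + {ffun 'I_d -> 'I_k} := inl ord0.
(* The factor exp([sq i]) cancels a Gaussian factor of the kernel; subtracting [sq i0] makes the
   coefficient of [f t] equal to 1. *)
pose a i := beta i * expR (sq i - sq i0).
pose xs i : 'rV[R]_d := \row_l (c l + u i l).
rewrite (_ : _ - _ = \sum_i a i * f (xs i)); last first.
  rewrite big_sumType big_ord1 /=; congr (_ + _).
    rewrite /a /= subrr expR0 !mul1r; congr f; apply/rowP => l.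
    by rewrite mxE /= divfK ?gt_eqF// addrC subrK.
  rewrite -sumrN; apply: eq_bigr => q _; rewrite -mulNr; congr (_ * _).
  rewrite /a /= mulNr; congr (- _); rewrite /cell_coef big_split/=; congr (_ * _).
  rewrite -expR_sum /sq -sumrB; congr expR; apply: eq_bigr => l _.
  by rewrite mulrBr /= divfK ?gt_eqF.
pose z i j : R := \sum_l 2 * gamma l ^+ 2 * (u i l * u j l).
have z0 i j : 0 <= z i j.
  apply: sumr_ge0 => l _; have /andP[? _] := uk i l; have /andP[? _] := uk j l.
  by rewrite mulr_ge0// mulr_ge0.
have zle i j : z i j <= G * (k%:R * h) ^+ 2.
  apply: le_trans (_ : (\sum_l 2 * gamma l ^+ 2) * (k%:R * h) ^+ 2 <= _).
    rewrite mulr_suml; apply: ler_sum => l _.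
    have /andP[? ?] := uk i l; have /andP[? ?] := uk j l.
    by rewrite ler_wpM2l// expr2 ler_pM.
  by rewrite ler_wpM2r ?sqr_ge0// lerDr.
have zG i j : z i j <= G.
  apply: le_trans (zle i j) _; rewrite ler_piMr// exprn_ile1//.
  by rewrite mulr_ge0 ?(ltW h0).
have aK i j : a i * a j * gauss_kernel gamma (xs i) (xs j) =
    expR (- sq i0) ^+ 2 * (beta i * beta j * expR (z i j)).
  rewrite /a mulrACA -(mulrA (beta i * beta j)) [RHS]mulrCA; congr (_ * _).
  rewrite /gauss_kernel expr2 -!expRD; congr expR.
  rewrite (_ : \sum_(l < d) _ = sq i + sq j - z i j); first by ring.
  rewrite /z /sq -big_split -sumrB; apply: eq_bigr => l _; rewrite !mxE /=; ring.
(* For fixed [i], [z i j] is one linear form evaluated at the scaled position of point [j], so its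
   powers below [k] are interpolated exactly. *)
have kill i n : (n < k)%N -> \sum_j beta j * z i j ^+ n = 0.
  move=> nk; pose w l := 2 * gamma l ^+ 2 * (u i l * h).
  rewrite big_sumType big_ord1 /= mul1r.
  rewrite (_ : z i (inl ord0) = \sum_l w l * s l); last first.
    by apply: eq_bigr => l _; rewrite /w /=; ring.
  rewrite -(prod_node_basis_exact _ _ nk) -big_split/= big1// => q _.
  rewrite mulNr (_ : z i (inr q) = \sum_l w l * (q l)%:R) ?subrr//.
  by apply: eq_bigr => l _; rewrite /w /=; ring.
have sumbeta : \sum_i `|beta i| <= A.
  rewrite big_sumType big_ord1 /= normr1 lerD2l; apply: ler_sum => q _.
  rewrite normrN normr_prod; apply: ler_prod => l _.
  by rewrite normr_ge0 basisB.
pose r i j : R := expR (z i j) - \sum_(n < k) z i j ^+ n / n`!%:R.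
pose W : R := G ^+ k * (k%:R * h) ^+ (2 * k) * expR G.
have rW i j : `|r i j| <= W.
  apply: le_trans (expR_taylor_le _ _) _; rewrite ger0_norm//.
  rewrite ler_pM ?exprn_ge0 ?expR_ge0 ?ler_expR//.
  by rewrite exprM -exprMn lerXn2r ?nnegrE// mulr_ge0 ?sqr_ge0.
have betar : \sum_i \sum_j beta i * beta j * expR (z i j) =
    \sum_i \sum_j beta i * beta j * r i j.
  apply: eq_bigr => i _; apply/eqP; rewrite -subr_eq0 -sumrB.
  under eq_bigr do rewrite -mulrBr /r opprB addrC subrK -mulrA.
  rewrite -mulr_sumr; under eq_bigr do rewrite mulr_sumr.
  rewrite exchange_big/= big1 ?mulr0// => n _.
  under eq_bigr do rewrite mulrA.
  by rewrite -mulr_suml kill ?mul0r.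
apply: (Hnorm_le1_dual f1).
  by rewrite mulr_gt0 ?exprn_gt0.
under eq_bigr => i _ do under eq_bigr => j _ do rewrite aK.
under eq_bigr do rewrite -mulr_sumr.
rewrite -mulr_sumr betar.
have W0 : 0 <= W.
  by rewrite !mulr_ge0 ?exprn_ge0 ?expR_ge0// mulr_ge0 ?(ltW h0).
have quadW : \sum_i \sum_j beta i * beta j * r i j <= A ^+ 2 * W.
  apply: le_trans (_ : (\sum_i `|beta i|) ^+ 2 * W <= _); last first.
    by rewrite ler_wpM2r// lerXn2r ?nnegrE ?sumr_ge0 ?(ltW A0).
  rewrite expr2 mulr_suml mulr_suml; apply: ler_sum => i _.
  rewrite mulr_sumr mulr_suml; apply: ler_sum => j _.
  by rewrite (le_trans (ler_norm _))// !normrM ler_wpM2l// mulr_ge0.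
apply: le_trans (ler_wpM2l (sqr_ge0 _) quadW) _.
apply: le_trans (_ : A ^+ 2 * W <= _).
  rewrite ler_piMl ?(mulr_ge0 (sqr_ge0 A) W0)// exprn_ile1 ?expR_ge0//.
  rewrite -expR0 ler_expR oppr_le0 sumr_ge0// => l _.
  by rewrite mulr_ge0 ?sqr_ge0.
(* The squared target carries the factor G^k e^G twice and [W] only once; this factor is at least
   1. *)
rewrite [leRHS](_ : _ = A ^+ 2 * (((G ^+ k * expR G) * (G ^+ k * expR G)) *
  (kk * h ^+ k) ^+ 2)); last by ring.
rewrite ler_wpM2l ?sqr_ge0// /W mulrAC mulnC exprM /kk -exprMn.
rewrite ler_wpM2r ?sqr_ge0// ler_peMl ?mulr_ge0 ?exprn_ge0 ?expR_ge0//.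
have eG1 : 1 <= expR G by rewrite -expR0 ler_expR.
by rewrite -[1]mulr1 ler_pM// exprn_ege1.
Qed.

End one_cell.

(** * Borel measurability and square integrability *)

Section borel_measurability.
Context {R : realType} {d : nat}.

Lemma measurable_coord (l : 'I_d) :
  measurable_fun (setT : set (g_sigma_algebraType (@open 'rV[R]_d)))
    (fun t : 'rV[R]_d => t ord0 l).
Proof.
apply: (measurability _ (RGenOpens.measurableE R)).
move=> _ [_ [a [b ->] <-]]; rewrite setTI; apply: sub_sigma_algebra.
have /continuousP := @coord_continuous R 1 d ord0 l; apply.
exact: interval_open.
Qed.

Lemma borel_measurable_dP (g : 'rV[R]_d -> R) :
  measurable_fun (setT : set (g_sigma_algebraType (@open 'rV[R]_d))) g ->
  borel_measurable_d g.
Proof. by move=> mg B mB; have := mg measurableT B mB; rewrite setTI. Qed.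

Lemma borel_measurable_prod (phi : 'I_d -> R -> R) :
  (forall l, measurable_fun setT (phi l)) ->
  borel_measurable_d (fun t : 'rV[R]_d => \prod_l phi l (t ord0 l)).
Proof.
move=> mphi; apply: borel_measurable_dP; apply: measurable_prod => l _.
by apply: (measurableT_comp (mphi l)); exact: measurable_coord.
Qed.

Lemma inL2_bounded (g : 'rV[R]_d -> R) (B : R) :
  borel_measurable_d g -> (forall t, `|g t| <= B) -> inL2 g.
Proof.
move=> mg gB; split => //; have [K K0 L2K] := @L2norm2_le R d.
have B0 : 0 <= B by exact: le_trans (gB 0).
apply: le_lt_trans (L2K (B ^+ 2) g (sqr_ge0 B) _) (ltry _) => t.
rewrite -[leLHS]mulr1 ler_pM ?sqr_ge0//.
  by rewrite -real_normK ?num_real// lerXn2r ?nnegrE.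
rewrite -expR0 ler_expR sumr_ge0// => l _.
by rewrite divr_ge0// sqr_ge0.
Qed.

Lemma inL2_0 : inL2 (fun _ : 'rV[R]_d => 0 : R).
Proof.
apply: (@inL2_bounded _ 0) => [|t]; last by rewrite normr0.
apply: borel_measurable_dP; exact: measurable_cst.
Qed.

End borel_measurability.

(** * Comparison of minimal errors *)

Section minimal_errors.
Context {R : realType} {d : nat} (gamma : 'I_d -> R).

Lemma std_functional_cont (L : ('rV[R]_d -> R) -> R) :
  std_functional L -> cont_lin_functional gamma L.
Proof.
move=> [t Lt]; split=> [f g a b _ _|]; first by rewrite !Lt.
by exists 1 => f _; rewrite mul1e Lt Hnorm_ge_eval.
Qed.

Lemma e_wor_all_le_std n : (e_wor_all gamma n <= e_wor_std gamma n)%E.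
Proof.
apply: le_ereal_inf => _ [L [a [stdL [La ->]]]]; exists L, a; split=> //.
by move=> j; exact: std_functional_cont.
Qed.

(** [J] is embedded into the [n] slots; a slot outside the image samples at 0 with coefficient 0, so
    formulas with fewer points also qualify. *)
Lemma e_wor_std_le (J : finType) n (xs : J -> 'rV[R]_d) (b : J -> 'rV[R]_d -> R)
    (s : \bar R) : (#|J| <= n)%N -> (forall j, inL2 (b j)) ->
  (forall f, (Hnorm gamma f <= 1)%E ->
    (L2norm (fun t => f t - \sum_j b j t * f (xs j))%R <= s)%E) ->
  (e_wor_std gamma n <= s)%E.
Proof.
move=> Jn bL2 err; pose sigma (x : J) : 'I_n := widen_ord Jn (enum_rank x).
have sigma_inj : injective sigma.
  by move=> x y /(congr1 val) /= /val_inj /enum_rank_inj.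
pose pre (j : 'I_n) := [pick x | sigma x == j].
pose L (j : 'I_n) (f : 'rV[R]_d -> R) := f (oapp xs 0 (pre j)).
pose a (j : 'I_n) : 'rV[R]_d -> R := oapp b (fun=> 0) (pre j).
apply: le_trans (_ : e_wor gamma L a <= s)%E.
  apply: ereal_inf_lbound; exists L, a; split.
    by move=> j; exists (oapp xs 0 (pre j)).
  by split=> // j; rewrite /a; case: (pre j) => [x|] //=; exact: inL2_0.
apply: ge_ereal_sup => _ [f [_ f1] <-].
rewrite (_ : (fun t => _) = (fun t => f t - \sum_j b j t * f (xs j))%R).
  exact: err.
apply/funext => t; congr (_ - _); rewrite /lin_alg.
rewrite [RHS](partition_big sigma xpredT)//=; apply: eq_bigr => j _.
rewrite /L /a /pre; case: pickP => [x /eqP <-|none] /=.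
  rewrite (big_pred1 x) 1?mulrC// => y; exact: inj_eq.
by rewrite mulr0 big_pred0.
Qed.

End minimal_errors.

(** * Piecewise interpolation on a grid *)

Section grid.
Context {R : realType} {d : nat} (gamma : 'I_d -> R) (k : nat) (k0 : (0 < k)%N).

(* The cube [-M, M)^d is cut into (2 M^2)^d cells of side 1/M. *)
Definition cell_corner (M : nat) (z : 'I_(2 * M ^ 2)) : R := z%:R / M%:R - M%:R.

Definition node_step (M : nat) : R := (k%:R * M%:R)^-1.

Definition grid_index (M : nat) : finType :=
  ({ffun 'I_d -> 'I_(2 * M ^ 2)} * {ffun 'I_d -> 'I_k})%type.

Definition grid_node (M : nat) (j : grid_index M) : 'rV[R]_d :=
  cell_node (node_step M) (fun l => cell_corner (j.1 l)) j.2.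

(** Half-open intervals make the cells disjoint, so at most one interpolation formula is active at
    each point. *)
Definition grid_factor (M : nat) (g : R) (z : 'I_(2 * M ^ 2)) (q : 'I_k) (x : R) : R :=
  \1_(`[cell_corner z, cell_corner z + M%:R^-1[%classic) x *
  cell_coef g (node_step M) (cell_corner z) x q.

Definition grid_coef (M : nat) (j : grid_index M) (t : 'rV[R]_d) : R :=
  \prod_l grid_factor (gamma l) (j.1 l) (j.2 l) (t ord0 l).

Lemma card_grid_index (M : nat) : #|grid_index M| = ((k * (2 * M ^ 2)) ^ d)%N.
Proof. by rewrite card_prod !card_ffun !card_ord mulnC -expnMn. Qed.

Lemma node_stepE (M : nat) : k%:R * node_step M = M%:R^-1.
Proof. by rewrite /node_step invfM mulVKf// pnatr_eq0 -lt0n. Qed.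

Lemma measurable_grid_factor (M : nat) (g : R) (z : 'I_(2 * M ^ 2)) (q : 'I_k) :
  measurable_fun setT (grid_factor g z q).
Proof.
apply: measurable_funM; first exact: measurable_indic.
have msub : measurable_fun setT (fun x : R => x - cell_corner z).
  exact: measurable_funB.
apply: measurable_funM.
  apply: (measurableT_comp (f := horner (node_basis q))).
    by apply: continuous_measurable_fun; exact: continuous_horner.
  exact: measurable_funM.
apply: measurableT_comp => //; apply: measurable_funM => //.
by apply: measurable_funB => //; exact: measurable_funX.
Qed.

(** Inside its cell the rescaled coordinate lies in [0, k], so [basisB] applies, and the node
    displacement is at most 1, which bounds the exponent by [gamma l ^+ 2]. *)
Lemma grid_coef_inL2 (M : nat) (j : grid_index M) : (0 < M)%N -> inL2 (grid_coef j).
Proof.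
move=> M0; have [B [B1 basisB]] := @node_basis_bounded R k.
have B0 : 0 <= B by exact: le_trans B1.
apply: (@inL2_bounded _ _ _ (\prod_l (B * expR (gamma l ^+ 2)))).
  apply: (borel_measurable_prod
    (phi := fun l => grid_factor (gamma l) (j.1 l) (j.2 l))) => l.
  exact: measurable_grid_factor.
move=> t; rewrite normr_prod; apply: ler_prod => l _; rewrite normr_ge0/=.
set x := t ord0 l; rewrite /grid_factor indicE.
case: (boolP (x \in _)); last first.
  by rewrite mul0r normr0 mulr_ge0 ?expR_ge0.
rewrite inE /= in_itv/= mul1r => /andP[cx xc].
have h0 : 0 < node_step M by rewrite invr_gt0 mulr_gt0 ?ltr0n.
rewrite normrM ler_pM//.
  apply: basisB; rewrite divr_ge0 ?subr_ge0 ?(ltW h0)//= ler_pdivrMr//.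
  by rewrite node_stepE lerBlDl ltW.
rewrite ger0_norm ?expR_ge0// ler_expR ler_piMr ?sqr_ge0//.
rewrite lerBlDr; apply: le_trans (_ : 1 <= _); last by rewrite lerDl sqr_ge0.
rewrite exprn_ile1 ?mulr_ge0 ?ler0n ?(ltW h0)//.
apply: le_trans (_ : k%:R * node_step M <= _).
  by rewrite ler_wpM2r ?(ltW h0)// ler_nat ltnW.
by rewrite node_stepE invf_le1 ?ltr0n// ler1n.
Qed.

(** The map x -> (x + M) M turns cells into unit intervals, so truncation recovers the cell number.
    Nonnegativity is recorded separately because truncation sends negative reals to 0. *)
Lemma grid_factor_in (M : nat) (g : R) (z : 'I_(2 * M ^ 2)) (q : 'I_k) (x : R) :
  (0 < M)%N -> grid_factor g z q x != 0 ->
  0 <= (x + M%:R) * M%:R /\ Num.truncn ((x + M%:R) * M%:R) = z.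
Proof.
move=> M0; have MR : 0 < M%:R :> R by rewrite ltr0n.
rewrite /grid_factor indicE; case: (boolP (x \in _)) => [|_]; last first.
  by rewrite mul0r eqxx.
rewrite inE /= in_itv/= /cell_corner => /andP[zx xz] _.
have zx' : z%:R <= (x + M%:R) * M%:R by rewrite -ler_pdivrMr// -lerBlDr.
have x0 : 0 <= (x + M%:R) * M%:R by exact: le_trans zx'.
split=> //; apply/eqP; rewrite truncn_eq// zx'/=.
by rewrite -ltr_pdivlMr// -ltrBrDr -natr1 mulrDl mul1r addrAC.
Qed.

(** In the cube only the cell of [t] contributes and [cell_error] applies. Outside, the formula
    vanishes, |f t| <= 1, and the exponential factor absorbs the power of M + 1. *)
Lemma grid_error : exists2 D : R, 1 <= D &
  forall (M : nat) f (t : 'rV[R]_d), (0 < M)%N -> (Hnorm gamma f <= 1)%E ->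
  (f t - \sum_(j : grid_index M) grid_coef j t * f (grid_node j)) ^+ 2 <=
    D / M.+1%:R ^+ k.*2 * expR (\sum_l t ord0 l ^+ 2 / 2).
Proof.
have [C C0 cellC] := @cell_error R k d gamma.
(* The three summands serve [1 <= D], the estimate inside the cube and the estimate outside it. *)
pose D : R := 1 + C ^+ 2 * 4 ^+ k + 4 ^+ k * k`!%:R * expR (1 / 2).
have Ca : 0 <= C ^+ 2 * 4 ^+ k by rewrite mulr_ge0 ?exprn_ge0 ?(ltW C0).
have Cb : 0 <= 4 ^+ k * k`!%:R * expR (1 / 2) :> R.
  by rewrite !mulr_ge0 ?exprn_ge0 ?expR_ge0.
have D1 : 1 <= D by rewrite /D -addrA lerDl addr_ge0.
exists D => // M f t M0 f1.
have MR : 0 < M%:R :> R by rewrite ltr0n.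
have M1 : 0 < M.+1%:R :> R by rewrite ltr0n.
have M1k : 0 < M.+1%:R ^+ k.*2 :> R by rewrite exprn_gt0.
have h0 : 0 < node_step M by rewrite invr_gt0 mulr_gt0 ?ltr0n.
have [/forallP inbox|] :=
    boolP [forall l, 0 <= (t ord0 l + M%:R) * M%:R < (2 * M ^ 2)%:R].
  have trunc_lt l : (Num.truncn ((t ord0 l + M%:R) * M%:R) < 2 * M ^ 2)%N.
    by have /andP[? ?] := inbox l; rewrite truncn_lt_nat.
  pose z := [ffun l => Ordinal (trunc_lt l)].
  have tz l : cell_corner (z l) <= t ord0 l < cell_corner (z l) + M%:R^-1.
    rewrite /cell_corner ffunE/=.
    have /andP[t0 _] := inbox l; have /andP[tl tu] := truncn_itv t0.
    rewrite lerBlDr ler_pdivrMr// tl/= addrAC ltrBrDr -{2}[M%:R^-1]mul1r.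
    by rewrite -mulrDl natr1 ltr_pdivlMr.
  rewrite (_ : \sum_j _ = \sum_(q : {ffun 'I_d -> 'I_k})
      (\prod_l cell_coef (gamma l) (node_step M) (cell_corner (z l))
         (t ord0 l) (q l)) *
      f (cell_node (node_step M) (fun l => cell_corner (z l)) q)); last first.
    rewrite -(pair_bigA _ (fun y q => grid_coef (y, q) t * f (grid_node (y, q)))).
    rewrite (bigD1 z)//= [X in _ + X]big1 ?addr0.
      apply: eq_bigr => q _; congr (_ * _); apply: eq_bigr => l _.
      by rewrite /grid_factor /= indicE mem_set ?mul1r//= in_itv/=.
    (* Any other cell differs from [z] in some coordinate, where its indicator vanishes at [t]. *)
    move=> y yz; apply: big1 => q _.
    have /existsP[l yl] : [exists l, y l != z l].
      rewrite -negb_forall; apply: contra yz => /forallP yz.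
      by apply/eqP/ffunP => l; exact/eqP.
    rewrite /grid_coef (bigD1 l)//= (_ : grid_factor _ _ _ _ = 0) ?mul0r//.
    apply/eqP; apply: contraNT yl => /(grid_factor_in M0)[_ e].
    by apply/eqP/val_inj; rewrite ffunE /= e.
  apply: le_trans (_ : (C * node_step M ^+ k) ^+ 2 <= _).
    rewrite -real_normK ?num_real// lerXn2r ?nnegrE//.
      by rewrite mulr_ge0 ?(ltW C0)// exprn_ge0// ltW.
    apply: cellC => //.
      by rewrite node_stepE invf_le1 ?ltr0n// ler1n.
    move=> l; have /andP[zt tz1] := tz l.
    by rewrite node_stepE subr_ge0 zt/= lerBlDl ltW.
  apply: le_trans (_ : D / M.+1%:R ^+ k.*2 * 1 <= _); last first.
    rewrite ler_wpM2l//; first by rewrite divr_ge0 ?(ltW M1k)// (le_trans ler01).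
    by rewrite -expR0 ler_expR sumr_ge0// => l _; rewrite divr_ge0 ?sqr_ge0.
  rewrite mulr1 ler_pdivlMr// exprMn -exprM muln2 -mulrA -exprMn.
  apply: le_trans (_ : C ^+ 2 * 4 ^+ k <= _); last first.
    by rewrite /D addrAC lerDr addr_ge0.
  rewrite ler_wpM2l ?sqr_ge0// -muln2 mulnC exprM lerXn2r ?nnegrE ?sqr_ge0//.
  (* This reduces to [node_step M * M.+1%:R <= 2], which follows from M + 1 <= 2 M <= 2 k M. *)
  rewrite (_ : 4 = 2 ^+ 2 :> R); last by ring.
  rewrite lerXn2r ?nnegrE ?mulr_ge0 ?(ltW h0)// /node_step.
  rewrite ler_pdivrMl ?mulr_gt0 ?ltr0n// -!natrM ler_nat.
  apply: (@leq_trans (M * 2)%N); last by rewrite leq_mul2r leq_pmull.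
  by rewrite muln2 -addnn -addn1 leq_add2l.
rewrite negb_forall => /existsP[l tl].
rewrite big1 ?subr0 => [|j _]; last first.
  rewrite /grid_coef (bigD1 l)//= (_ : grid_factor _ _ _ _ = 0) ?mul0r//.
  apply/eqP; apply: contraNT tl => /(grid_factor_in M0)[t0 e].
  by rewrite t0/= -truncn_lt_nat// e.
have f2 : f t ^+ 2 <= 1.
  have : (`|f t|%:E <= 1)%E by exact: le_trans (Hnorm_ge_eval gamma f t) f1.
  by rewrite lee_fin -real_normK ?num_real// => ?; rewrite exprn_ile1.
apply: le_trans f2 _; rewrite mulrAC ler_pdivlMr// mul1r.
set x := t ord0 l in tl *.
have Mx : M%:R <= `|x|.
  rewrite leNgt; apply: contra tl => /ltr_normlP[xM Mx].
  rewrite mulr_ge0 ?(ltW MR)//=; last by rewrite -lerBlDr sub0r lerNl ltW.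
  rewrite natrM natrX expr2 mulrA ltr_pM2r// mulr_natl mulr2n.
  by rewrite ltrD2r.
have -> : expR (\sum_j t ord0 j ^+ 2 / 2) =
    expR (x ^+ 2 / 2) * expR (\sum_(j | j != l) t ord0 j ^+ 2 / 2).
  by rewrite -expRD (bigD1 l).
apply: le_trans (_ : D * expR (x ^+ 2 / 2) <= _); last first.
  rewrite mulrA ler_peMr ?mulr_ge0 ?expR_ge0 ?(le_trans ler01)//.
  by rewrite -expR0 ler_expR sumr_ge0// => j _; rewrite divr_ge0 ?sqr_ge0.
(* Here (M + 1)^2 <= (1 + |x|)^2 <= 2 (1 + x^2) = 4 y; then y^k <= k! e^y with e^y = e^(1/2)
   e^(x^2/2) yields the last summand of [D]. *)
pose y := (1 + x ^+ 2) / 2.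
have y0 : 0 <= y by rewrite divr_ge0// addr_ge0// sqr_ge0.
apply: le_trans (_ : (4 * y) ^+ k <= _).
  have y40 : 0 <= 4 * y by rewrite mulr_ge0.
  rewrite -muln2 mulnC exprM lerXn2r ?nnegrE ?exprn_ge0//.
  have : M.+1%:R ^+ 2 <= (1 + `|x|) ^+ 2.
    by rewrite lerXn2r ?nnegrE ?addr_ge0// -natr1 addrC lerD2l.
  have := sqr_ge0 (1 - `|x|); have := real_normK (num_real x).
  by rewrite /y; nra.
rewrite exprMn; apply: le_trans (_ : 4 ^+ k * (k`!%:R * expR y) <= _).
  by rewrite ler_wpM2l ?exprn_ge0// expR_ge_pow.
rewrite /y mulrDl expRD !mulrA ler_wpM2r ?expR_ge0//.
by rewrite /D lerDr addr_ge0.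
Qed.

End grid.

(** * Upper bound and choice of the grid *)

Section upper_bound.
Context {R : realType} {d : nat} (gamma : 'I_d -> R).

(** The exponent [d.+1], where the grid size has [d], makes the budget grow with [M] even in
    dimension 0, so that a largest affordable [M] exists. *)
Lemma e_wor_std_grid (k : nat) : (0 < k)%N -> exists2 S : R, 0 <= S &
  forall M n : nat, ((k * (2 * M ^ 2)) ^ d.+1 <= n)%N ->
    (e_wor_std gamma n <= (S / M.+1%:R ^+ k)%:E)%E.
Proof.
move=> k0; have [D D1 gridD] := grid_error gamma k0.
have [K K0 L2K] := @L2norm2_le R d.
have D0 : 0 <= D by exact: le_trans D1.
exists (Num.sqrt (D * K)); first exact: sqrtr_ge0.
move=> M n Mn.
have M1 : 0 < M.+1%:R :> R by rewrite ltr0n.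
have L2norm_bound (e : 'rV[R]_d -> R) :
    (forall t, e t ^+ 2 <= D / M.+1%:R ^+ k.*2 * expR (\sum_l t ord0 l ^+ 2 / 2)) ->
    (L2norm e <= (Num.sqrt (D * K) / M.+1%:R ^+ k)%:E)%E.
  have DM0 : 0 <= D / M.+1%:R ^+ k.*2 by rewrite divr_ge0// exprn_ge0.
  move=> /(L2K _ _ DM0) /= eK.
  have -> : Num.sqrt (D * K) / M.+1%:R ^+ k =
      Num.sqrt (D / M.+1%:R ^+ k.*2 * K).
    rewrite mulrAC [RHS]sqrtrM ?mulr_ge0 ?(ltW K0)//; congr (_ * _).
    by rewrite -muln2 exprM -(exprVn _ 2) sqrtr_sqr ger0_norm// invr_ge0 exprn_ge0.
  change (L2norm e <= sqrte (D / M.+1%:R ^+ k.*2 * K)%:E)%E.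
  by rewrite lee_sqrt// lee_fin mulr_ge0// ltW.
(* For M = 0 the budget is 0 and no sample may be used; the zero approximation suffices because
   [1 <= D]. *)
have [M0|M0] := posnP M.
  apply: (@e_wor_std_le _ _ gamma void _ (fun=> 0) (fun=> fun=> 0)).
  - by rewrite card_void.
  - by case.
  - move=> f f1; apply: L2norm_bound => t; rewrite big1 => [|[]]; rewrite subr0 M0 expr1n divr1.
    have : (`|f t|%:E <= 1)%E by exact: le_trans (Hnorm_ge_eval gamma f t) f1.
    rewrite lee_fin -real_normK ?num_real// => ft1.
    apply: le_trans (_ : 1 * 1 <= _); first by rewrite mulr1 exprn_ile1.
    rewrite ler_pM// -expR0 ler_expR sumr_ge0// => l _.
    by rewrite divr_ge0 ?sqr_ge0.
apply: (e_wor_std_le (xs := @grid_node R d k M) (b := @grid_coef R d gamma k M)).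
- rewrite card_grid_index; apply: leq_trans Mn; rewrite (expnS _ d) leq_pmull//.
  by rewrite muln_gt0 k0 muln_gt0 expn_gt0 M0.
- by move=> j; exact: grid_coef_inL2.
- by move=> f f1; apply: L2norm_bound => t; exact: gridD.
Qed.

End upper_bound.

Theorem theorem1 (R : realType) (d : nat) (gamma : 'I_d -> R)
  (hgamma : forall l, 0 < gamma l) (p : R) (hp : 0 < p) :
  exists C : R, forall n : nat, (0 < n)%N ->
    (e_wor_all gamma n <= e_wor_std gamma n)%E /\
    (e_wor_std gamma n <= (C * n%:R `^ (- p))%:E)%E.
Proof.
(* With this [k], (M + 1)^k dominates (M + 1)^(2 (d + 1) p), which is the order of n^p when n = O((M
   + 1)^(2 (d + 1))). *)
pose k := (Num.truncn (2 * d.+1%:R * p)).+1.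
have kp : 2 * d.+1%:R * p <= k%:R.
  by rewrite ltW// truncnS_gt.
have [S S0 eS] := @e_wor_std_grid R d gamma k isT.
pose A : R := ((2 * k) ^ d.+1)%N%:R `^ p.
have A0 : 0 <= A by exact: powR_ge0.
exists (S * A) => n n0; split; first exact: e_wor_all_le_std.
pose admissible M := ((k * (2 * M ^ 2)) ^ d.+1 <= n)%N.
have adm0 : exists M, admissible M by exists 0; rewrite /admissible exp0n ?muln0 ?exp0n.
have adm_le M : admissible M -> (M <= n)%N.
  move=> /(leq_trans _); apply; case: M => // M.
  apply: leq_trans (_ : (k * (2 * M.+1 ^ 2)) ^ 1 <= _)%N; last first.
    by rewrite leq_pexp2l// !muln_gt0 expn_gt0.
  rewrite expn1 mulnA; apply: leq_trans (leq_pmull _ _) => //.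
  by rewrite -{1}(expn1 M.+1) leq_pexp2l.
(* [M] is the finest grid that [n] samples afford; its maximality bounds [n] by the cost of M +
   1. *)
case: (ex_maxnP adm0 adm_le) => M admM maxM.
apply: le_trans (eS M n admM) _; rewrite lee_fin -mulrA ler_wpM2l//.
have n0R : 0 < n%:R :> R by rewrite ltr0n.
rewrite powRN -[leLHS]mul1r ler_pdivrMr ?exprn_gt0// mulrAC.
rewrite ler_pdivlMr ?powR_gt0// mul1r.
have nM : (n <= (2 * k) ^ d.+1 * M.+1 ^ (2 * d.+1))%N.
  rewrite expnM -expnMn leqNgt; apply/negP => Mn.
  suff : admissible M.+1 by move/maxM; rewrite ltnn.
  by rewrite /admissible mulnA (mulnC k) ltnW.
apply: le_trans (_ : ((2 * k) ^ d.+1 * M.+1 ^ (2 * d.+1))%N%:R `^ p <= _).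
  by rewrite ge0_ler_powR ?nnegrE ?ler_nat// ltW.
rewrite natrM powRM// ler_wpM2l// natrX -powR_mulrn// -powRrM.
rewrite -powR_mulrn// ler_powR ?ler1n//.
by apply: le_trans kp; rewrite natrM.
Qed.
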